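(* For every integer $n\ge 4$, $$\sum_{\substack{j\ge 2,\;k,l\ge 1\\ j+k+l=n}} 2^{j-1}\,\zeta(j,k,l)+\sum_{\substack{j\ge 2,\;k\ge 1\\ j+k=n-1}} 2^{j}\,\zeta(j,k,1) = n\,\zeta(n-1,1)+3\,\zeta(n-2,2)+\zeta(2,n-2)+2\,\zeta(n).$$
   Context: For positive integers $s_1,\dots,s_d$ with $s_1>1$, the multiple zeta value is $\zeta(s_1,\dots,s_d)=\sum_{k_1>\dots>k_d>0} k_1^{-s_1}\cdots k_d^{-s_d}$ (so the largest summation index carries the first exponent). All summation indices are integers. *)

(* Defs.v *)
From HB Require Import structures.
From mathcomp Require Import all_boot all_order all_algebra.
From mathcomp Require Import all_classical all_reals all_analysis.

Set Implicit Arguments.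
Unset Strict Implicit.
Unset Printing Implicit Defensive.

Import Order.TTheory GRing.Theory Num.Theory.

Local Open Scope classical_set_scope.
Local Open Scope ring_scope.

Definition mzv_index (d : nat) : set (d.-tuple nat) :=
  [set k : d.-tuple nat | sorted gtn k /\ all (fun m => 0 < m)%N k].

Arguments mzv_index d : clear implicits.

(* The terms are nonnegative, so the iterated series is the unordered sum over
   all index tuples k_1 > ... > k_d > 0.  A divergent sum is sent to 0 by
   [fine]; this does not occur when all the s_i are positive and s_1 > 1. *)
Definition mzv (R : realType) (d : nat) (s : d.-tuple nat) : R :=
  fine (\esum_(k in mzv_index d)
          (\prod_(i < d) (tnth k i)%:R ^- tnth s i)%:E).

Arguments mzv R {d} s.

(* Main.v *)
(* Write [z(...)] for [zeta(...)] and sum over all [a, b >= 2] with [a + b = n - 1]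
   the two expansions of the product [z(a) z(b,1)].

   Ordering the indices gives
     z(a) z(b,1) = z(a,b,1) + z(b,a,1) + z(b,1,a) + z(a+b,1) + z(b,a+1),
   while partial fractions, [1/x^a y^b] in terms of [1/(x+y)], give weights which
   sum up to powers of 2: the left-hand side of the theorem minus
     (2 sum z(a,b,1) + sum z(j,k,l) + 3 z(n-2,1,1)).
   What remains are four unweighted sums of fixed weight:
     sum_{a+b=n} z(a,b) = z(n),         sum_{a+b=n-1} z(a,b,1) = z(n-1,1) + z(n-2,2),
     sum_{j+k+l=n} z(j,k,l) = z(n),     sum_{a+b=n-1} z(a,1,b) = z(n-1,1) + z(2,n-2),
   (first entry at least 2), which follow from summing a geometric progression in
   the exponents and then telescoping over the largest index; those in
   the second row are sums of instances of the cyclic sum formula of Hoffman and Ohno.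

   All series have nonnegative terms, so rearrangements are carried out in
   [\bar R], each identity being written without subtraction; finiteness is only
   needed at the end to cancel the common terms. *)

Require Import Defs.
From HB Require Import structures.
From mathcomp Require Import all_boot all_order all_algebra.
From mathcomp Require Import all_classical all_reals all_analysis.
From mathcomp Require Import ring lra zify.

Import Order.TTheory GRing.Theory Num.Theory.
Import numFieldNormedType.Exports.

Local Open Scope ring_scope.

(** * Nonnegative series over the positive integers: reordering and telescoping *)

Definition psum (R : realType) (f : nat -> \bar R) : \bar R :=
  \esum_(i in [set: nat]) f i.+1.

Arguments psum {R} f.

Local Notation "'\S_' x F" := (psum (fun x => F%E))
  (at level 36, x name, F at level 36, right associativity).

Section PositiveSums.
Context {R : realType}.
Implicit Types (f g : nat -> \bar R) (h : nat -> nat -> \bar R).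

Lemma psum_ge0 f : (forall i, 0 <= f i)%E -> (0 <= \S_ i f i)%E.
Proof. by move=> f0; apply: esum_ge0 => i _. Qed.

Lemma eq_psum f g : (forall i, (0 < i)%N -> f i = g i) ->
  \S_ i f i = \S_ i g i.
Proof. by move=> fg; apply: eq_esum => i _; exact: fg. Qed.

Lemma le_psum f g : (forall i, (0 < i)%N -> f i <= g i)%E ->
  (\S_ i f i <= \S_ i g i)%E.
Proof. by move=> fg; apply: le_esum => i _; exact: fg. Qed.

Lemma psumD f g : (forall i, 0 <= f i)%E -> (forall i, 0 <= g i)%E ->
  \S_ i (f i + g i) = (\S_ i f i + \S_ i g i)%E.
Proof. by move=> f0 g0; rewrite /psum esumD. Qed.

Lemma psumZ f c : 0 <= c -> (forall i, 0 <= f i)%E ->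
  \S_ i (c%:E * f i) = (c%:E * \S_ i f i)%E.
Proof.
move=> c0 f0; rewrite /psum -!nneseries_esumT//.
- by rewrite nneseriesZl// => i _; exact: f0.
- by move=> i; rewrite mule_ge0.
Qed.

Lemma psum_sum n h : (forall i j, 0 <= h i j)%E ->
  \S_ i (\sum_(j < n) h i j) = (\sum_(j < n) \S_ i h i j)%E.
Proof. by move=> h0; rewrite /psum esum_sum. Qed.

Lemma psumC h : (forall i j, 0 <= h i j)%E ->
  \S_ i \S_ j h i j = \S_ j \S_ i h i j.
Proof.
move=> h0; rewrite /psum -!nneseries_esumT; last 2 first.
- by move=> i; apply: esum_ge0 => j _.
- by move=> i; apply: esum_ge0 => j _.
under eq_eseriesr do rewrite -nneseries_esumT//.
under [RHS]eq_eseriesr do rewrite -nneseries_esumT//.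
by rewrite nneseries_interchange.
Qed.

Lemma psum_shift f t : (forall i, 0 <= f i)%E ->
  \S_ s f (s + t)%N = \S_ y (if (t < y)%N then f y else 0).
Proof.
move=> f0; rewrite /psum.
rewrite [RHS](eq_esum (b := fun i =>
  if i \in [set i | (t <= i)%N]%classic then f i.+1 else 0%E)); last first.
  by move=> i _; rewrite ltnS; case: ifPn => ti;
    [rewrite mem_set|rewrite memNset//; exact/negP].
rewrite -esum_mkcond [RHS](reindex_esum setT _ (addn t)); last first.
  split=> [i _|i j _ _ /addnI//|i /= ti]; first by rewrite /= leq_addr.
  by exists (i - t)%N => //; rewrite subnKC.
by apply: eq_esum => i _; rewrite addSn addnC.
Qed.

Lemma psum_below f y : (forall i, 0 <= f i)%E ->
  \S_ t (if (t < y)%N then f t else 0) = (\sum_(t < y.-1) f t.+1)%E.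
Proof.
move=> f0; rewrite /psum -nneseries_esumT; last by move=> n; case: ifP.
rewrite (nneseries_split 0 y.-1); last by move=> k _; case: ifP.
rewrite add0n eseries0 ?adde0.
  by rewrite big_mkord; apply: eq_bigr => i _; rewrite (_ : (_ < y)%N) //; have := ltn_ord i; lia.
by move=> i yi _; rewrite ifF//; lia.
Qed.

(** With [y = s + t], free gaps become pairs [t < y]. Read backwards, this turns the finite sums
    left by telescoping into sums over gaps. *)
Lemma psum_triangle h : (forall i j, 0 <= h i j)%E ->
  \S_ s \S_ t h t (s + t)%N = \S_ y (\sum_(t < y.-1) h t.+1 y).
Proof.
move=> h0; rewrite psumC//.
under [LHS]eq_esum do rewrite psum_shift//.
rewrite -/(psum (fun t => \S_ y (if (t < y)%N then h t y else 0))) psumC; last first.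
  by move=> i j; case: ifP.
by apply: eq_psum => y _; rewrite psum_below.
Qed.

(** Trichotomy [x > y], [x < y], [x = y], the larger index being written as the smaller one plus a
    gap. *)
Lemma psum_split h : (forall i j, 0 <= h i j)%E ->
  \S_ x \S_ y h x y =
  (\S_ x \S_ y h (x + y)%N y + \S_ x \S_ y h x (y + x)%N + \S_ x h x x)%E.
Proof.
move=> h0.
have -> : \S_ x \S_ y h (x + y)%N y = \S_ x \S_ y (if (y < x)%N then h x y else 0).
  rewrite psumC// [RHS]psumC; last by move=> i j; case: ifP.
  by apply: eq_psum => y _; rewrite -psum_shift.
rewrite -psumD; last 2 first.
- by move=> i; apply: psum_ge0 => j; case: ifP.
- by move=> i; exact: psum_ge0.
rewrite -psumD; last 2 first.
- by move=> i; apply: adde_ge0; apply: psum_ge0 => j //; case: ifP.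
- by [].
apply: eq_psum => x x0.
have -> : h x x = \S_ y (if y == x then h x y else 0).
  rewrite /psum (eq_esum (b := fun i =>
    if i \in [set x.-1]%classic then h x i.+1 else 0%E)); last first.
    by move=> i _; rewrite in_set1; case: x x0.
  by rewrite -esum_mkcond esum_set1//; case: x x0.
rewrite psum_shift// -psumD; last 2 first.
- by move=> i; case: ifP.
- by move=> i; case: ifP.
rewrite -psumD; last 2 first.
- by move=> i; apply: adde_ge0; case: ifP.
- by move=> i; case: ifP.
by apply: eq_psum => y y0; case: ltngtP => _; rewrite ?adde0 ?add0e.
Qed.

Lemma invr_natM_succ k : (0 < k)%N ->
  k%:R^-1 * k.+1%:R^-1 = k%:R^-1 - k.+1%:R^-1 :> R.
Proof.
by move=> k0; rewrite -natr1; field; rewrite natr1 !pnatr_eq0 -!lt0n k0.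
Qed.

Lemma psum_telescope c :
  \S_ x ((x + c)%:R^-1 * (x + c).+1%:R^-1)%:E = (c.+1%:R^-1)%:E :> \bar R.
Proof.
rewrite /psum -nneseries_esumT; last by move=> n; rewrite lee_fin.
apply/cvg_lim => //.
rewrite (_ : (fun n => _) = EFin \o (fun n : nat => c.+1%:R^-1 - (n + c).+1%:R^-1)); last first.
  apply/funext => n /=; rewrite sumEFin big_mkord; congr EFin.
  elim: n => [|n IH]; first by rewrite big_ord0 add0n subrr.
  by rewrite big_ord_recr/= IH invr_natM_succ// subrKA.
apply: cvg_EFin; first by near=> n.
suff : ((fun n => c.+1%:R^-1 - (n + c).+1%:R^-1 : R) @ \oo -->
    (c.+1%:R^-1 - 0 : R))%classic by rewrite subr0.
apply: cvgB; first exact: cvg_cst.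
have := @cvg_harmonic R; rewrite -(cvg_shiftn c); exact.
Unshelve. all: by end_near. Qed.

(** Since [1/(N(N + r))] is [1/r] times the sum over [t < r] of [1/((N + t)(N + t + 1))], the series
    splits into [r] telescoping ones with offsets [y + t]. *)
Lemma psum_telescope_mul (c : R) y r : 0 <= c -> (0 < r)%N ->
  \S_ x (c * ((x + y)%:R^-1 * (x + y + r)%:R^-1))%:E =
  (c * (r%:R^-1 * \sum_(t < r) (y + t).+1%:R^-1))%:E :> \bar R.
Proof.
move=> c0 r0.
have e x : (0 < x)%N -> (c * ((x + y)%:R^-1 * (x + y + r)%:R^-1))%:E =
   ((c * r%:R^-1)%:E * \sum_(t < r) ((x + (y + t))%:R^-1 * (x + (y + t)).+1%:R^-1)%:E)%E.
  move=> x0; rewrite sumEFin -EFinM -mulrA; congr (_ * _)%:E.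
  have -> : \sum_(i < r) ((x + (y + i))%:R^-1 * (x + (y + i)).+1%:R^-1) =
      (x + y)%:R^-1 - (x + y + r)%:R^-1 :> R.
    elim: {r0} r => [|r IH]; first by rewrite big_ord0 addn0 subrr.
    rewrite big_ord_recr/= IH invr_natM_succ ?addn_gt0 ?x0// !addnA subrKA.
    by rewrite addnS.
  by rewrite !natrD; field; rewrite -!natrD !pnatr_eq0 -!lt0n !addn_gt0 x0 r0.
rewrite (eq_psum _ _ e) psumZ; last 2 first.
- by rewrite mulr_ge0.
- by move=> i; apply: sume_ge0 => j _; rewrite lee_fin.
rewrite (psum_sum r (fun x t => ((x + (y + t))%:R^-1 * (x + (y + t)).+1%:R^-1)%:E)); last first.
  by move=> i j; rewrite lee_fin.
under eq_bigr do rewrite psum_telescope.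
by rewrite sumEFin -EFinM mulrA.
Qed.

End PositiveSums.

(** * Partial fractions and geometric progressions as polynomial identities *)

Section PartialFractions.
Context {F : comPzRingType}.
Implicit Types (a b c u v w : F).

(** For [u = 1/(x + y)], [v = 1/y], [w = 1/x] this is a finite geometric progression of ratio [u/v],
    written without division; the hypothesis encodes [w = uv/(v - u)]. *)
Lemma geometric_fraction u v w m : w * (v - u) = u * v ->
  \sum_(i < m) u ^+ i.+2 * v ^+ (m - i) + u ^+ m.+1 * w = v ^+ m * (u * w).
Proof.
move=> uvw; elim: m => [|m IH]; first by rewrite big_ord0 add0r expr1 mul1r.
rewrite big_ord_recr/= subSnn expr1.
have -> : \sum_(i < m) u ^+ i.+2 * v ^+ (m.+1 - i) =
    v * \sum_(i < m) u ^+ i.+2 * v ^+ (m - i).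
  rewrite mulr_sumr; apply: eq_bigr => i _.
  by rewrite subSn ?exprS 1?mulrCA// ltnW.
move/(canRL (addrK _)): IH => ->.
rewrite mulrBr -!addrA [v ^+ _.+1]exprS -[RHS]mulrA -[RHS]addr0; congr (_ + _).
rewrite !exprS; transitivity (u * u ^+ m * (u * v - w * (v - u))); first by ring.
by rewrite uvw subrr mulr0.
Qed.

(** Here [a = 1/x], [c = 1/y], [u = 1/(x + y)]. Each further factor [a] raises the exponents in the
    sum, and the hypothesis splits its product with the remainder [u ^+ k * c]. *)
Lemma partial_fraction a c u k : a * c = u * (a + c) ->
  a ^+ k * c = \sum_(j < k) u ^+ j.+1 * a ^+ (k - j) + u ^+ k * c.
Proof.
move=> acu; elim: k => [|k IH]; first by rewrite big_ord0 add0r.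
rewrite exprS -mulrA IH big_ord_recr/= subSnn expr1 mulrDr mulr_sumr -addrA.
congr (_ + _); last first.
  by rewrite mulrCA acu mulrA -exprSr mulrDr.
apply: eq_bigr => j _.
by rewrite mulrCA subSn -?exprS// ltnW.
Qed.

(** Source of the powers of 2. Pulling out [a * b = u * (a + b)] shows that the left-hand side
    satisfies [S_(m+1) = u (a^(m+2) + b^(m+2)) + 2 u S_m]: multiplying by [a] and by [b] each
    reproduces [S_m]. *)
Lemma partial_fraction_pow2 a b u m : a * b = u * (a + b) ->
  \sum_(i < m.+1) a ^+ i.+1 * b ^+ (m - i).+1 =
  \sum_(i < m.+1) 2 ^+ i * u ^+ i.+1 * (a ^+ (m - i).+1 + b ^+ (m - i).+1).
Proof.
move=> abu; elim: m => [|m IH]; first by rewrite !big_ord1 !expr1 mul1r.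
have -> : \sum_(i < m.+2) a ^+ i.+1 * b ^+ (m.+1 - i).+1 =
    u * ((a + b) * \sum_(i < m.+2) a ^+ i * b ^+ (m.+1 - i)).
  rewrite mulrA -abu mulr_sumr; apply: eq_bigr => i _.
  by rewrite !exprS mulrACA.
rewrite mulrDl !mulr_sumr big_ord_recr/= subnn expr0 mulr1.
rewrite [X in _ + _ + X]big_ord_recl/= expr0 subn0 mul1r.
have -> : \sum_(i < m.+1) a * (a ^+ i * b ^+ (m.+1 - i)) =
    \sum_(i < m.+1) a ^+ i.+1 * b ^+ (m - i).+1.
  by apply: eq_bigr => i _; rewrite mulrA -exprS subSn// -ltnS.
have -> : \sum_(i < m.+1) b * (a ^+ bump 0 i * b ^+ (m.+1 - bump 0 i)) =
    \sum_(i < m.+1) a ^+ i.+1 * b ^+ (m - i).+1.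
  by apply: eq_bigr => i _; rewrite mulrCA -exprS /bump add1n subSS.
rewrite IH [RHS]big_ord_recl/= !subn0 mul1r expr1.
have -> : \sum_(i < m.+1) 2 ^+ bump 0 i * u ^+ (bump 0 i).+1 *
      (a ^+ (m.+1 - bump 0 i).+1 + b ^+ (m.+1 - bump 0 i).+1) =
    2 * u * \sum_(i < m.+1) 2 ^+ i * u ^+ i.+1 *
      (a ^+ (m - i).+1 + b ^+ (m - i).+1).
  rewrite mulr_sumr; apply: eq_bigr => i _; rewrite /bump add1n subSS.
  by rewrite exprS [u ^+ _.+2]exprS; ring.
rewrite -!exprS; ring.
Qed.

(* The partial fraction expansions of [1/(x^i y^j)] with [i + j = m + 3] and
   [i, j >= 2], summed, where [a = 1/x], [b = 1/y] and [u = 1/(x + y)]; the terms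
   with [u ^+ 1] cancel. *)
Lemma partial_fraction_inner a b u m : a * b = u * (a + b) ->
  \sum_(i < m) a ^+ i.+2 * b ^+ (m - i).+1
  + \sum_(i < m.+1) u ^+ i.+2 * (a ^+ (m - i).+1 + b ^+ (m - i).+1)
  + u ^+ m.+2 * (a + b) =
  \sum_(i < m.+1) 2 ^+ i.+1 * (u ^+ i.+2 * (a ^+ (m - i).+1 + b ^+ (m - i).+1)).
Proof.
move=> abu.
have pf c d : c * d = u * (c + d) -> c ^+ m.+2 * d =
    u * c ^+ m.+2 + \sum_(i < m.+1) u ^+ i.+2 * c ^+ (m - i).+1 + u ^+ m.+2 * d.
  move=> cdu; rewrite (partial_fraction _ _ _ _ cdu) big_ord_recl/= subn0 expr1.
  congr (_ + _ + _); apply: eq_bigr => i _.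
  by rewrite /bump add1n subSS subSn// -ltnS.
have Eb := pf b a; have Ea := pf _ _ abu.
rewrite mulrC addrC abu in Eb; move/(_ erefl): Eb => Eb.
(* The two extreme terms [a * b ^+ m.+2] and [a ^+ m.+2 * b] have an exponent 1; they are split off
   and expanded by [Ea] and [Eb]. *)
have := partial_fraction_pow2 _ _ _ m.+1 abu.
rewrite big_ord_recl/= big_ord_recr/= [RHS]big_ord_recl/= subn0 !expr1 mul1r.
have -> : \sum_(i < m) a ^+ (bump 0 i).+1 * b ^+ (m.+1 - bump 0 i).+1 =
    \sum_(i < m) a ^+ i.+2 * b ^+ (m - i).+1.
  by apply: eq_bigr => i _; rewrite /bump add1n subSS.
have -> : \sum_(i < m.+1) 2 ^+ bump 0 i * u ^+ (bump 0 i).+1 *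
      (a ^+ (m.+1 - bump 0 i).+1 + b ^+ (m.+1 - bump 0 i).+1) =
    \sum_(i < m.+1) 2 ^+ i.+1 * (u ^+ i.+2 * (a ^+ (m - i).+1 + b ^+ (m - i).+1)).
  by apply: eq_bigr => i _; rewrite /bump add1n subSS mulrA.
rewrite /bump add1n subnn expr1 (mulrC a) Eb Ea => H.
under [X in _ + X + _ = _]eq_bigr do rewrite mulrDr.
rewrite big_split/=; apply: (addrI (u * (a ^+ m.+2 + b ^+ m.+2))).
by rewrite -H; ring.
Qed.

End PartialFractions.

(** * Double and triple sums over gaps, and the relations between them *)

Definition recip (R : realType) (k : nat) : R := k%:R^-1.

Definition psum2 (R : realType) (f : nat -> nat -> R) : \bar R :=
  \S_ x \S_ y (f x y)%:E.

Definition psum3 (R : realType) (f : nat -> nat -> nat -> R) : \bar R :=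
  \S_ x \S_ y \S_ z (f x y z)%:E.

Arguments psum2 {R} f.
Arguments psum3 {R} f.

(* The summation indices are encoded by their positive gaps: [x + y + z],
   [y + z] and [z] run through all strictly decreasing triples. *)
Definition zeta1 (R : realType) (i : nat) : \bar R := \S_ x (recip R x ^+ i)%:E.

Definition zeta2 (R : realType) (i j : nat) : \bar R :=
  psum2 (fun x y => recip R (x + y) ^+ i * recip R y ^+ j).

Definition zeta3 (R : realType) (i j k : nat) : \bar R :=
  psum3 (fun x y z => recip R (x + y + z) ^+ i * recip R (y + z) ^+ j
                        * recip R z ^+ k).

Lemma recip_ge0 (R : realType) k : 0 <= recip R k.
Proof. by rewrite invr_ge0. Qed.

Ltac nonneg := intros; repeat (cbv beta; match goal with
  | |- is_true (0 <= recip _ _) => exact: recip_ge0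
  | |- is_true (0 <= _ ^+ _) => apply: exprn_ge0
  | |- is_true (0 <= _ * _) => apply: mulr_ge0
  | |- is_true (0 <= _ + _) => apply: addr_ge0
  | |- is_true (0 <= _%:R) => exact: ler0n
  | |- is_true (0 <= \sum_(i < _) _) => apply: sumr_ge0 => *
  | |- is_true (@Order.le ereal_display _ _ _) =>
    first [rewrite lee_fin | apply: psum_ge0 => * | apply: adde_ge0
          | apply: sume_ge0 => *]
  | |- _ => by []
  end).

Section MultipleSums.
Context {R : realType}.
Implicit Types (f g : nat -> nat -> nat -> R).
Local Notation e := (recip R).

(** This identity and the next supply, with [u = e (x + y)], the hypotheses of the partial fraction
    lemmas and of [geometric_fraction] respectively. *)
Lemma recipM x y : (0 < x)%N -> (0 < y)%N -> e x * e y = e (x + y) * (e x + e y).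
Proof.
by move=> x0 y0; rewrite /recip natrD; field; rewrite -natrD !pnatr_eq0 -!lt0n addn_gt0 x0 y0.
Qed.

Lemma recipMB x y : (0 < x)%N -> (0 < y)%N -> e x * (e y - e (x + y)) = e (x + y) * e y.
Proof.
by move=> x0 y0; rewrite /recip natrD; field; rewrite -natrD !pnatr_eq0 -!lt0n addn_gt0 x0 y0.
Qed.

Lemma eq_psum2 (f g : nat -> nat -> R) :
  (forall x y, (0 < x)%N -> (0 < y)%N -> f x y = g x y) -> psum2 f = psum2 g.
Proof. by move=> fg; apply: eq_psum => x x0; apply: eq_psum => y y0; rewrite fg. Qed.

Lemma eq_psum3 f g :
  (forall x y z, (0 < x)%N -> (0 < y)%N -> (0 < z)%N -> f x y z = g x y z) ->
  psum3 f = psum3 g.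
Proof.
by move=> fg; do 2 (apply: eq_psum => ? ?); apply: eq_psum => z z0; rewrite fg.
Qed.

Lemma psum2D (f g : nat -> nat -> R) :
  (forall x y, 0 <= f x y) -> (forall x y, 0 <= g x y) ->
  psum2 (fun x y => f x y + g x y) = (psum2 f + psum2 g)%E.
Proof.
move=> f0 g0; rewrite /psum2 -psumD; [|nonneg..].
by apply: eq_psum => x _; rewrite -psumD; nonneg.
Qed.

Lemma psum3D f g :
  (forall x y z, 0 <= f x y z) -> (forall x y z, 0 <= g x y z) ->
  psum3 (fun x y z => f x y z + g x y z) = (psum3 f + psum3 g)%E.
Proof.
move=> f0 g0; rewrite /psum3 -psumD; [|nonneg..].
by apply: eq_psum => x _; exact: psum2D.
Qed.

Lemma psum2_sum n (f : nat -> nat -> nat -> R) :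
  (forall i x y, 0 <= f i x y) ->
  psum2 (fun x y => \sum_(i < n) f i x y) = (\sum_(i < n) psum2 (f i))%E.
Proof.
move=> f0; rewrite /psum2 -(psum_sum n (fun x i => \S_ y (f i x y)%:E)); [|nonneg].
apply: eq_psum => x _; rewrite -(psum_sum n (fun y i => (f i x y)%:E)); [|nonneg].
by apply: eq_psum => y _; rewrite sumEFin.
Qed.

Lemma psum3_sum n (f : nat -> nat -> nat -> nat -> R) :
  (forall i x y z, 0 <= f i x y z) ->
  psum3 (fun x y z => \sum_(i < n) f i x y z) = (\sum_(i < n) psum3 (f i))%E.
Proof.
move=> f0; rewrite /psum3 -(psum_sum n (fun x i => psum2 (f i x))); last first.
  by rewrite /psum2; nonneg.
by apply: eq_psum => x _; exact: (psum2_sum n (fun i => f i x)).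
Qed.

Lemma psum3Z f c : 0 <= c -> (forall x y z, 0 <= f x y z) ->
  psum3 (fun x y z => c * f x y z) = (c%:E * psum3 f)%E.
Proof.
move=> c0 f0; rewrite /psum3 -psumZ; [|nonneg..].
apply: eq_psum => x _; rewrite -psumZ; [|nonneg..].
by apply: eq_psum => y _; rewrite -psumZ; nonneg.
Qed.

Lemma psum2C (f : nat -> nat -> R) : (forall x y, 0 <= f x y) ->
  psum2 f = psum2 (fun x y => f y x).
Proof. by move=> f0; rewrite /psum2 psumC//; nonneg. Qed.

Lemma psum3C12 f : (forall x y z, 0 <= f x y z) ->
  psum3 f = psum3 (fun x y z => f y x z).
Proof. by move=> f0; rewrite /psum3 psumC//; nonneg. Qed.

Lemma psum3C23 f : (forall x y z, 0 <= f x y z) ->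
  psum3 f = psum3 (fun x y z => f x z y).
Proof. by move=> f0; apply: eq_psum => x _; exact: psum2C. Qed.

Lemma psum2_triangle (f : nat -> nat -> R) : (forall x y, 0 <= f x y) ->
  \S_ y (\sum_(t < y.-1) (f t.+1 y)%:E) = psum2 (fun s t => f t (s + t)%N).
Proof. by move=> f0; rewrite -(psum_triangle (fun t y => (f t y)%:E)); nonneg. Qed.

Lemma psum3_triangle f : (forall x y z, 0 <= f x y z) ->
  psum2 (fun x y => \sum_(t < y.-1) f x t.+1 y) =
  psum3 (fun x s t => f x t (s + t)%N).
Proof.
move=> f0; apply: eq_psum => x _; rewrite -/(psum2 (fun s t => f x t (s + t)%N)).
rewrite -(psum2_triangle (f x))//.
by apply: eq_psum => y _; rewrite sumEFin.
Qed.

(** The left-hand [zeta2 R m.+2 1] is the remainder of the geometric progression in the exponents.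
    Telescoping over [x] leaves a harmonic sum up to [y]: its terms [t < y] give the right-hand
    [zeta2], its last term gives [zeta1]. *)
Lemma depth2_sum_formula m :
  (\sum_(i < m.+1) zeta2 R i.+2 (m - i).+1 + zeta2 R m.+2 1 =
   zeta2 R m.+2 1 + zeta1 R m.+3)%E.
Proof.
have -> : zeta2 R m.+2 1 = psum2 (fun x y => e (x + y) ^+ m.+2 * e x).
  rewrite /zeta2 psum2C; last by nonneg.
  by apply: eq_psum2 => x y _ _; rewrite addnC.
rewrite /zeta2 -(psum2_sum _ (fun i x y => e (x + y) ^+ i.+2 * e y ^+ (m - i).+1)); last by nonneg.
rewrite -psum2D; [|nonneg..].
(* The offset 0 in [x + 0] gives the summand the shape of [psum_telescope_mul]. *)
rewrite (eq_psum2 _ (fun x y => e y ^+ m.+1 * (e (x + 0) * e (x + 0 + y)))); last first.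
  move=> x y x0 y0; rewrite addn0 [e x * _]mulrC -(geometric_fraction _ _ _ m.+1 (recipMB _ _ x0 y0)).
  by congr (_ + _); apply: eq_bigr => i _; rewrite subSn// -ltnS.
rewrite psum2C; last by nonneg.
transitivity (\S_ y (\sum_(t < y.-1) (e y ^+ m.+2 * e t.+1)%:E + (e y ^+ m.+3)%:E)).
  apply: eq_psum => y y0; rewrite psum_telescope_mul//; last by nonneg.
  rewrite sumEFin -EFinD -mulr_sumr -/(e y) mulrA -exprSr.
  case: y y0 => // y _; rewrite big_ord_recr/= mulrDr -exprSr.
  by congr (_ * _ + _)%:E; apply: eq_bigr => t _; rewrite add0n.
rewrite psumD; [|nonneg..]; congr adde.
rewrite (psum2_triangle (fun t y => e y ^+ m.+2 * e t)); last by nonneg.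
rewrite psum2C; last by nonneg.
by apply: eq_psum2 => x y _ _; rewrite addnC.
Qed.

(* In terms of [p > q > r], the sum of [p^-i q^-j (p - r)^-1]: the connecting sum in
   the proof of Hoffman and Ohno. *)
Definition cyclic_sum (i j : nat) : \bar R :=
  psum3 (fun x y z => e (x + y + z) ^+ i * e (y + z) ^+ j * e (x + y)).

(** For [p > q > r] the exponents of [p] and [r] form a geometric progression with remainder
    [cyclic_sum a.+1 k]. Summing over [p] telescopes and introduces a new index below [r], so the
    roles of [p, q] pass to [q, r]. *)
Lemma cyclic_sum_formula a k :
  (\sum_(i < a) zeta3 R i.+2 k (a - i) + cyclic_sum a.+1 k =
   cyclic_sum k a.+1 + zeta2 R k.+1 a.+1)%E.
Proof.
rewrite /zeta3 -(psum3_sum a (fun i x y z =>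
  e (x + y + z) ^+ i.+2 * e (y + z) ^+ k * e z ^+ (a - i))); last by nonneg.
rewrite -psum3D; [|nonneg..].
rewrite (eq_psum3 _ (fun x y z => (e z ^+ a * e (y + z) ^+ k) *
    (e (x + y) * e (x + y + z)))); last first.
  move=> x y z x0 y0 z0.
  have xy0 : (0 < x + y)%N by rewrite addn_gt0 x0.
  have H := geometric_fraction _ _ _ a (recipMB _ _ xy0 z0).
  rewrite [e (x + y) * e (x + y + z)]mulrC [RHS]mulrAC -H.
  rewrite mulrDl mulr_suml; congr (_ + _); last by rewrite mulrAC.
  by apply: eq_bigr => i _; rewrite mulrAC.
rewrite psum3C12; last by nonneg.
rewrite psum3C23; last by nonneg.
transitivity (psum2 (fun y z => \sum_(t < z.-1) (e (y + z) ^+ k * e z ^+ a.+1 * e (y + t.+1))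
   + e (y + z) ^+ k.+1 * e z ^+ a.+1)).
  apply: eq_psum => y _; apply: eq_psum => z z0.
  rewrite psum_telescope_mul//; last by nonneg.
  rewrite -mulr_sumr -/(e z); case: z z0 => // z _.
  rewrite big_ord_recr/= addnS -/(e _) !exprSr; congr (_%:E).
  under [in LHS]eq_bigr do rewrite -addnS -/(e _).
  ring.
rewrite psum2D; [|nonneg..]; congr (_ + _)%E.
(* With [q = y + z], [r = z] and [s = z - t], the factor [e (y + t)] is [1/(q - s)], so the chain
   [q > r > s] carries a connecting sum again. *)
rewrite (psum3_triangle (fun y t z => e (y + z) ^+ k * e z ^+ a.+1 * e (y + t))); last by nonneg.
rewrite psum3C23; last by nonneg.
by apply: eq_psum3 => y t s _ _ _; rewrite [(s + t)%N]addnC addnA.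
Qed.

(* The summands [zeta3 R m.+2 1 1] cancel, but only once they are known to be finite. *)
Lemma hoffman_relation m :
  (\sum_(i < m.+1) zeta3 R i.+2 (m - i).+1 1 + (zeta3 R m.+2 1 1 + zeta3 R m.+2 1 1) =
   zeta3 R m.+2 1 1 + zeta2 R m.+2 2 + zeta3 R m.+2 1 1 + zeta2 R m.+3 1)%E.
Proof.
(* The geometric progression below leaves the remainder [p^-(m+2) x^-1 z^-1] with [p = x + y + z];
   partial fractions of [1/(xz)] make it two equal triple sums. *)
have -> : (zeta3 R m.+2 1 1 + zeta3 R m.+2 1 1)%E =
    psum3 (fun x y z => e (x + y + z) ^+ m.+2 * e x * e z).
  rewrite [RHS]psum3C12; last by nonneg.
  rewrite {1}/zeta3 psum3C23; last by nonneg.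
  rewrite -psum3D; [|nonneg..].
  apply: eq_psum3 => x y z x0 y0 z0.
  rewrite -[in RHS]mulrA recipM// !expr1 -addnA [(z + y)%N]addnC addnA.
  by rewrite [(y + x)%N]addnC; ring.
rewrite /zeta3 -(psum3_sum _ (fun i x y z =>
  e (x + y + z) ^+ i.+2 * e (y + z) ^+ (m - i).+1 * e z ^+ 1)); last by nonneg.
rewrite -psum3D; [|nonneg..].
rewrite (eq_psum3 _ (fun x y z => (e (y + z) ^+ m.+1 * e z) *
    (e (x + 0) * e (x + 0 + (y + z))))); last first.
  move=> x y z x0 y0 z0.
  have yz0 : (0 < y + z)%N by rewrite addn_gt0 y0.
  have H := geometric_fraction _ _ _ m.+1 (recipMB _ _ x0 yz0).
  rewrite addn0 [e x * _]mulrC [RHS]mulrAC -H addnA.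
  rewrite mulrDl mulr_suml expr1; congr (_ + _).
  by apply: eq_bigr => i _; rewrite subSn// -ltnS.
rewrite psum3C12; last by nonneg.
rewrite psum3C23; last by nonneg.
transitivity (psum2 (fun y z =>
   \sum_(t < z.-1) (e (y + z) ^+ m.+2 * e z * e t.+1)
   + e (y + z) ^+ m.+2 * e z ^+ 2
   + \sum_(t < y.-1) (e (y + z) ^+ m.+2 * e z * e (z + t.+1))
   + e (y + z) ^+ m.+3 * e z ^+ 1)).
  apply: eq_psum => y y0; apply: eq_psum => z z0.
  rewrite psum_telescope_mul//; [|nonneg|by rewrite addn_gt0 y0].
  rewrite -!mulr_sumr -/(e (y + z)); congr (_%:E).
  rewrite [(y + z)%N in X in _ * (_ * X)]addnC.
  (* The harmonic sum up to [y + z] is cut at [z] and at its end; the four pieces are the four terms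
     on the right of the lemma. *)
  rewrite (_ : \sum_(t < z + y) (0 + t).+1%:R^-1 =
     \sum_(t < z.-1) e t.+1 + e z + (\sum_(t < y.-1) e (z + t.+1) + e (y + z))); last first.
    rewrite big_split_ord/=; case: z z0 => // z _; case: y y0 => // y _.
    rewrite !big_ord_recr/= [(y.+1 + _)%N]addnC; congr (_ + _ + (_ + _)) => //.
    - by apply: eq_bigr => i _; rewrite addnS.
    - by rewrite addnS.
  rewrite !exprSr; ring.
rewrite psum2D; [|nonneg..]; congr (_ + _)%E.
rewrite psum2D; [|nonneg..].
rewrite psum2D; [|nonneg..]; congr (_ + _ + _)%E.
- rewrite (psum3_triangle (fun y t z => e (y + z) ^+ m.+2 * e z * e t)); last by nonneg.
  by apply: eq_psum3 => y s t _ _ _; rewrite addnA.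
- rewrite psum2C; last by nonneg.
  rewrite (psum3_triangle (fun z t y => e (y + z) ^+ m.+2 * e z * e (z + t))); last by nonneg.
  rewrite psum3C12; last by nonneg.
  rewrite psum3C23; last by nonneg.
  by apply: eq_psum3 => s t z _ _ _; rewrite [in LHS]mulrAC [(z + t)%N]addnC.
Qed.

(** The index [x] is compared with [z] first; when it is larger, the gap above [z] is compared with
    [y]. This gives five orderings. *)
Lemma stuffle a b :
  psum3 (fun x y z => e x ^+ a * e (y + z) ^+ b * e z) =
  (zeta3 R a b 1 + zeta3 R b a 1 + zeta2 R (a + b) 1
   + zeta3 R b 1 a + zeta2 R b a.+1)%E.
Proof.
pose f x y z := e x ^+ a * e (y + z) ^+ b * e z.
have f0 x y z : 0 <= f x y z by rewrite /f; nonneg.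
have split_xz y : \S_ x \S_ z (f x y z)%:E =
    (\S_ x \S_ z (f (x + z)%N y z)%:E + \S_ x \S_ z (f x y (z + x)%N)%:E
     + \S_ x (f x y x)%:E)%E.
  by rewrite (psum_split (fun x z => (f x y z)%:E)); nonneg.
have split_xy z : \S_ x \S_ y (f (x + z)%N y z)%:E =
    (\S_ x \S_ y (f (x + y + z)%N y z)%:E + \S_ x \S_ y (f (x + z)%N (y + x)%N z)%:E
     + \S_ x (f (x + z)%N x z)%:E)%E.
  by rewrite (psum_split (fun x y => (f (x + z)%N y z)%:E)); nonneg.
rewrite psum3C12//.
transitivity (psum3 (fun y x z => f (x + z)%N y z) + psum3 (fun y x z => f x y (z + x)%N)
   + psum2 (fun y x => f x y x))%E.
  rewrite /psum3 /psum2 -psumD; [|nonneg..]; rewrite -psumD; [|nonneg..].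
  by apply: eq_psum => y _; exact: split_xz.
have -> : psum3 (fun y x z => f (x + z)%N y z) =
    (zeta3 R a b 1 + zeta3 R b a 1 + zeta2 R (a + b) 1)%E.
  rewrite psum3C12; last by nonneg.
  rewrite psum3C23; last by nonneg.
  rewrite psum3C12; last by nonneg.
  transitivity (psum3 (fun z x y => f (x + y + z)%N y z)
     + psum3 (fun z x y => f (x + z)%N (y + x)%N z)
     + psum2 (fun z x => f (x + z)%N x z))%E.
    rewrite /psum3 /psum2 -psumD; [|nonneg..]; rewrite -psumD; [|nonneg..].
    by apply: eq_psum => z _; exact: split_xy.
  congr (_ + _ + _)%E.
  - rewrite psum3C12; last by nonneg.
    rewrite psum3C23; last by nonneg.
    by apply: eq_psum3 => x y z _ _ _; rewrite /f expr1.
  - rewrite psum3C12; last by nonneg.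
    rewrite psum3C23; last by nonneg.
    rewrite psum3C12; last by nonneg.
    by apply: eq_psum3 => y x z _ _ _; rewrite /f expr1; ring.
  - rewrite psum2C; last by nonneg.
    by apply: eq_psum2 => x z _ _; rewrite /f expr1 -exprD.
congr (_ + _ + _)%E.
- rewrite psum3C23; last by nonneg.
  by apply: eq_psum3 => y z x _ _ _; rewrite /f expr1 addnA; ring.
- by apply: eq_psum2 => y x _ _; rewrite /f exprSr; ring.
Qed.

(** Partial fractions of [1/(x^k z)] in terms of [x + z] make [x + z] the middle index, with [y] the
    gap above it. *)
Lemma shuffle_inner i k :
  psum3 (fun x y z => e (x + y + z) ^+ i * e x ^+ k * e z) =
  (\sum_(j < k) zeta3 R i j.+1 (k - j) + zeta3 R i k 1)%E.
Proof.
rewrite psum3C12; last by nonneg.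
rewrite {1}/zeta3 -(psum3_sum k (fun j x y z =>
  e (x + y + z) ^+ i * e (y + z) ^+ j.+1 * e z ^+ (k - j))); last by nonneg.
rewrite [X in (X + _)%E]psum3C23; last by nonneg.
rewrite -psum3D; [|nonneg..].
apply: eq_psum3 => y x z x0 y0 z0.
rewrite -mulrA (partial_fraction _ _ _ _ (recipM _ _ y0 z0)) expr1 mulrDr mulr_sumr.
congr (_ + _); last by rewrite mulrA [(y + x)%N]addnC.
apply: eq_bigr => j _.
by rewrite mulrA [(x + y)%N]addnC -!addnA [(z + x)%N]addnC.
Qed.

(** This is the sum of [e (x + y + z) ^+ i * (e x ^+ k + e (y + z) ^+ k) * e z]: [shuffle_inner]
    gives the first two summands, and the power of [e (y + z)] gives the last. *)
Definition inner_shuffle (i k : nat) : \bar R :=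
  (\sum_(j < k) zeta3 R i j.+1 (k - j) + zeta3 R i k 1 + zeta3 R i k 1)%E.

(** This is [partial_fraction_inner] at [a = e x], [b = e (y + z)], multiplied by [e z] and summed
    over all gaps. *)
Lemma shuffle_sum m :
  (\sum_(i < m) psum3 (fun x y z => e x ^+ i.+2 * e (y + z)%N ^+ (m - i).+1 * e z)%R
   + \sum_(i < m.+1) inner_shuffle i.+2 (m - i).+1 + inner_shuffle m.+2 1 =
   \sum_(i < m.+1) (2 ^+ i.+1)%:E * inner_shuffle i.+2 (m - i).+1)%E.
Proof.
pose F i k x y z : R := (e (x + y + z) ^+ i * (e x ^+ k + e (y + z) ^+ k)) * e z.
have F0 i k x y z : 0 <= F i k x y z by rewrite /F; nonneg.
have inE i k : inner_shuffle i k = psum3 (F i k).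
  rewrite /inner_shuffle -shuffle_inner -psum3D; [|nonneg..].
  by apply: eq_psum3 => x y z _ _ _; rewrite /F expr1 mulrDr mulrDl.
under [X in (_ + X + _ = _)%E]eq_bigr do rewrite inE.
under [RHS]eq_bigr do rewrite inE -psum3Z//.
rewrite inE -(psum3_sum _ (fun i x y z =>
  e x ^+ i.+2 * e (y + z) ^+ (m - i).+1 * e z)); last by nonneg.
rewrite -(psum3_sum m.+1 (fun i => F i.+2 (m - i).+1)); last by nonneg.
rewrite -(psum3_sum m.+1 (fun i x y z => 2 ^+ i.+1 * F i.+2 (m - i).+1 x y z)); last by nonneg.
rewrite -psum3D; [|nonneg..]; rewrite -psum3D; [|nonneg..].
apply: eq_psum3 => x y z x0 y0 z0.
have yz0 : (0 < y + z)%N by rewrite addn_gt0 y0.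
rewrite /F -!mulr_suml -!mulrDl !expr1.
under [RHS]eq_bigr do rewrite mulrA.
rewrite -[RHS]mulr_suml; congr (_ * _).
by rewrite -addnA -(partial_fraction_inner _ _ _ m (recipM _ _ x0 yz0)).
Qed.

End MultipleSums.

(** * Identification with [mzv], and finiteness *)

Section MultipleZetaValues.
Context {R : realType}.
Local Notation e := (recip R).

Lemma psum3_esum (f : nat -> nat -> nat -> R) : (forall x y z, 0 <= f x y z) ->
  psum3 f = \esum_(p in [set: nat * (nat * nat)])
    (f p.1.+1 p.2.1.+1 p.2.2.+1)%:E.
Proof.
move=> f0; rewrite /psum3 /psum.
transitivity (\esum_(x in [set: nat])
    \esum_(p in [set: nat] `*`` (fun=> [set: nat])) (f x.+1 p.1.+1 p.2.+1)%:E)%classic.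
  by apply: eq_esum => x _; rewrite esum_esum// => *; rewrite lee_fin.
rewrite esum_esum; last by move=> *; rewrite lee_fin.
by rewrite [X in esum X](_ : _ = [set: nat * (nat * nat)]%classic)//; apply/seteqP; split.
Qed.

Lemma mzv3E i j k : mzv R [tuple i; j; k] = fine (zeta3 R i j k).
Proof.
rewrite /mzv /zeta3 psum3_esum; last by nonneg.
congr fine; pose t p : 3.-tuple nat :=
  [tuple (p.1.+1 + p.2.1.+1 + p.2.2.+1)%N; (p.2.1.+1 + p.2.2.+1)%N; p.2.2.+1].
rewrite (reindex_esum [set: nat * (nat * nat)]%classic _ t).
  apply: eq_esum => -[x [y z]] _ /=; congr (_%:E).
  by rewrite !big_ord_recl big_ord0 /= !(tnth_nth 0%N)/= mulr1 !exprVn mulrA.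
split.
- by move=> [x [y z]] _; split=> //=; rewrite /gtn/=; lia.
- move=> [x [y z]] [x' [y' z']] _ _ /(congr1 val)/= [].
  by move=> E1 E2 E3; congr (_, (_, _)); lia.
- move=> k3 []; case/tupleP: k3 => a k3; case/tupleP: k3 => b k3.
  case/tupleP: k3 => c k3; rewrite (tuple0 k3) /= => /and3P[ba cb _] /and4P[_ _ c0 _].
  (* Gaps are stored minus one, because [psum] evaluates at successors. *)
  exists (a - b.+1, (b - c.+1, c.-1))%N => //.
  by apply: val_inj => /=; rewrite /gtn /= in ba cb; congr [:: _; _; _]; lia.
Qed.

Lemma mzv2E i j : mzv R [tuple i; j] = fine (zeta2 R i j).
Proof.
rewrite /mzv /zeta2 /psum2 /psum esum_esum; last by move=> *; nonneg.
congr fine; pose t (p : nat * nat) : 2.-tuple nat :=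
  [tuple (p.1.+1 + p.2.+1)%N; p.2.+1].
rewrite (reindex_esum ([set: nat] `*`` (fun=> [set: nat]))%classic _ t).
  apply: eq_esum => -[x y] _ /=; congr (_%:E).
  by rewrite !big_ord_recl big_ord0 /= !(tnth_nth 0%N)/= mulr1 !exprVn.
split.
- by move=> [x y] _; split=> //=; rewrite /gtn/=; lia.
- move=> [x y] [x' y'] _ _ /(congr1 val)/= [].
  by move=> E1 E2; congr (_, _); lia.
- move=> k2 []; case/tupleP: k2 => b k2.
  case/tupleP: k2 => c k2; rewrite (tuple0 k2) /= => /andP[cb _] /and3P[_ c0 _].
  exists (b - c.+1, c.-1)%N => //.
  by apply: val_inj => /=; rewrite /gtn /= in cb; congr [:: _; _]; lia.
Qed.

Lemma mzv1E i : mzv R [tuple i] = fine (zeta1 R i).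
Proof.
rewrite /mzv /zeta1 /psum.
congr fine; pose t (p : nat) : 1.-tuple nat := [tuple p.+1].
rewrite (reindex_esum [set: nat]%classic _ t).
  apply: eq_esum => x _ /=; congr (_%:E).
  by rewrite !big_ord_recl big_ord0 /= !(tnth_nth 0%N)/= mulr1 !exprVn.
split.
- by move=> x _; split.
- by move=> x x' _ _ /(congr1 val)/= [].
- move=> k1 []; case/tupleP: k1 => c k1; rewrite (tuple0 k1) /= => _ /andP[c0 _].
  by exists c.-1 => //; apply: val_inj => /=; rewrite prednK.
Qed.

Lemma recip_le1 x : e x <= 1.
Proof. by case: x => [|x]; rewrite /recip ?invr0// invf_le1 ?ltr0n// ler1n. Qed.

Lemma recip_exp_le x i j : (j <= i)%N -> e x ^+ i <= e x ^+ j.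
Proof. by move=> ji; apply: ler_wiXn2l => //; [exact: recip_ge0|exact: recip_le1]. Qed.

Lemma recip_expS_le x j : e x ^+ j.+1 <= e x.
Proof. exact: (@recip_exp_le _ _ 1). Qed.

Lemma recip_le x y : (0 < x)%N -> (x <= y)%N -> e y <= e x.
Proof.
by move=> x0 xy; rewrite lef_pV2 ?posrE ?ltr0n ?ler_nat//; exact: leq_trans xy.
Qed.

(** Comparison with the telescoping series of [1/((x + c - 1)(x + c))]. It removes the largest
    index, reducing finiteness to lower depth. *)
Lemma psum_recip_sq_le c (d : R) : 0 <= d -> (0 < c)%N ->
  (\S_ x (e (x + c) ^+ 2 * d)%:E <= (e c * d)%:E)%E.
Proof.
move=> d0; case: c => // c _.
have := @psum_telescope_mul R d c 1 d0 isT.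
rewrite big_ord1/= invr1 mul1r addn0 -/(e c.+1) [d * _]mulrC => <-.
apply: le_psum => x x0; rewrite lee_fin addn1 -addnS [leRHS]mulrC ler_wpM2r//.
by rewrite expr2 ler_wpM2r ?recip_ge0// addnS recip_le// addn_gt0 x0.
Qed.

Lemma zeta1_fin i : zeta1 R i.+2 \is a fin_num.
Proof.
rewrite ge0_fin_numE; last by rewrite /zeta1; nonneg.
(* The bound is the value of the telescoping series of [2/(x(x + 1))], which dominates that of
   [1/x^2]. *)
apply: le_lt_trans (ltry (2 * (1 * 1))).
have := @psum_telescope_mul R 2 0 1 ltac:(by []) isT.
rewrite big_ord1/= !invr1 => <-.
apply: le_psum => x x0; rewrite lee_fin addn0.
apply: (@le_trans _ _ (e x ^+ 2)); first exact: recip_exp_le.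
rewrite mulrCA expr2 ler_wpM2l ?recip_ge0// addn1.
rewrite ler_pdivlMr ?ltr0n// mulrC ler_pdivrMr ?ltr0n//.
by rewrite -natrM ler_nat; lia.
Qed.

Lemma zeta2_fin i j : zeta2 R i.+2 j.+1 \is a fin_num.
Proof.
rewrite ge0_fin_numE; last by rewrite /zeta2 /psum2; nonneg.
have := zeta1_fin 0; rewrite ge0_fin_numE; last by rewrite /zeta1; nonneg.
apply: le_lt_trans.
rewrite /zeta2 psum2C; last by nonneg.
apply: le_psum => y y0; rewrite [e y ^+ 2]expr2.
apply: le_trans (psum_recip_sq_le _ (e y) (recip_ge0 _ _) y0).
apply: le_psum => x x0; rewrite lee_fin ler_pM ?exprn_ge0 ?recip_ge0//.
  exact: recip_exp_le.
exact: recip_expS_le.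
Qed.

Lemma psum3_le_zeta2 (f : nat -> nat -> nat -> R) : (forall x y z, 0 <= f x y z) ->
  (forall x y z, (0 < x)%N -> (0 < y)%N -> (0 < z)%N ->
    f x y z <= e (x + (y + z)) ^+ 2 * (e (y + z) * e z)) ->
  (psum3 f <= zeta2 R 2 1)%E.
Proof.
move=> f0 fle.
rewrite psum3C12// psum3C23; last by move=> *; exact: f0.
apply: le_psum => y y0; apply: le_psum => z z0.
rewrite expr1 expr2 -mulrA.
have yz0 : (0 < y + z)%N by rewrite addn_gt0 y0.
apply: le_trans (psum_recip_sq_le _ (e (y + z) * e z) _ yz0); last by nonneg.
by apply: le_psum => x x0; rewrite lee_fin fle.
Qed.

Lemma zeta3_fin i j k : zeta3 R i.+2 j.+1 k.+1 \is a fin_num.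
Proof.
rewrite ge0_fin_numE; last by rewrite /zeta3 /psum3; nonneg.
have := zeta2_fin 0 0; rewrite ge0_fin_numE; last by rewrite /zeta2 /psum2; nonneg.
apply: le_lt_trans; apply: psum3_le_zeta2; first by nonneg.
move=> x y z _ _ _; rewrite addnA mulrA.
apply: ler_pM; [by nonneg..| |exact: recip_expS_le].
by apply: ler_pM; [by nonneg..|exact: recip_exp_le|exact: recip_expS_le].
Qed.

(** From [st <= s^2 + t^2] with [s = e (y + z)], [t = e (x + y)], the summand is at most
    [g x y z + g z y x]; both terms have the same finite sum by symmetry. *)
Lemma cyclic_sum_fin_ge2 i j : cyclic_sum i.+2 j.+1 \is a @fin_num R.
Proof.
rewrite ge0_fin_numE; last by rewrite /cyclic_sum /psum3; nonneg.
have := zeta2_fin 0 0; rewrite ge0_fin_numE; last by rewrite /zeta2 /psum2; nonneg.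
move=> fin2.
pose g x y z : R := e (x + (y + z)) ^+ 2 * e (y + z) ^+ 2.
have g0 x y z : 0 <= g x y z by rewrite /g; nonneg.
have gfin : (psum3 g < +oo)%E.
  apply: le_lt_trans fin2; apply: psum3_le_zeta2 => // x y z x0 y0 z0.
  rewrite /g ler_wpM2l ?exprn_ge0 ?recip_ge0// expr2 ler_wpM2l ?recip_ge0//.
  by rewrite recip_le// leq_addl.
apply: (@le_lt_trans _ _ (psum3 (fun x y z => g x y z + g z y x))).
  apply: le_psum => x _; apply: le_psum => y _; apply: le_psum => z _.
  rewrite lee_fin /g -addnA (_ : z + (y + x) = x + (y + z))%N; last by lia.
  rewrite [(y + x)%N]addnC.
  rewrite -mulrDr -mulrA.
  apply: ler_pM; [by nonneg..|exact: recip_exp_le|].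
  apply: (@le_trans _ _ (e (y + z) * e (x + y))).
    by rewrite ler_wpM2r ?recip_ge0 ?recip_expS_le.
  by have := sqr_ge0 (e (y + z) - e (x + y));
    have := sqr_ge0 (e (y + z));
    have := sqr_ge0 (e (x + y)); nra.
rewrite psum3D//.
rewrite [X in (_ + X)%E]psum3C12//; rewrite [X in (_ + X)%E]psum3C23//.
rewrite [X in (_ + X)%E]psum3C12//.
exact: lte_add_pinfty.
Qed.

(** The largest index has exponent only 1 here, so the previous bound does not apply;
    [cyclic_sum_formula] with an empty sum swaps the exponents. *)
Lemma cyclic_sum_fin_1 j : cyclic_sum 1 j.+2 \is a @fin_num R.
Proof.
have := @cyclic_sum_formula R 0 j.+2; rewrite big_ord0 add0e => ->.
by rewrite fin_numD cyclic_sum_fin_ge2 zeta2_fin.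
Qed.

End MultipleZetaValues.

(** * Reindexing of finite sums *)

Section IndexSums.
Context {V : nmodType}.

Lemma sum_nat_solve (N c p : nat) (F : nat -> V) : (p < N)%N ->
  \sum_(1 <= l < N | (c + l == p)%N) F l = if (c < p)%N then F (p - c)%N else 0.
Proof.
move=> pN; have [cp|pc] := ltnP c p.
  rewrite (eq_bigl (fun l => l == p - c)%N); last by move=> l; apply/eqP/eqP; lia.
  by rewrite big_nat1_eq ifT//; lia.
by rewrite big_nat_cond big1// => l; lia.
Qed.

Lemma sum_nat_lt (a b c : nat) (F : nat -> V) : (c <= b)%N ->
  \sum_(a <= i < b | (i < c)%N) F i = \sum_(a <= i < c) F i.
Proof. by move=> cb; rewrite [RHS](big_nat_widen _ _ _ _ _ cb). Qed.

(** Both sides run over the triples [i + j + k = m.+1] with [k > 0]; on the left [a = i + k]. *)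
Lemma sum_triangle_exchange m (F : nat -> nat -> nat -> V) :
  \sum_(a < m.+2) \sum_(i < a) F i (m.+1 - a)%N (a - i)%N =
  \sum_(i < m.+1) \sum_(j < (m - i).+1) F i j ((m - i).+1 - j)%N.
Proof.
transitivity (\sum_(a < m.+2) \sum_(i < m.+1 | (i < a)%N) F i (m.+1 - a)%N (a - i)%N).
  apply: eq_bigr => a _; rewrite (big_ord_widen m.+1 (fun i => F i (m.+1 - a)%N (a - i)%N))//.
  by rewrite -ltnS.
rewrite (exchange_big_dep xpredT)//=; apply: eq_bigr => i _.
rewrite (reindex_inj rev_ord_inj)/=.
rewrite (big_ord_widen m.+2 (fun j => F i j ((m - i).+1 - j)%N)); last by lia.
have im := ltn_ord i.
apply: eq_big => [j|j /= ij]; first by have jm := ltn_ord j; lia.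
have jm := ltn_ord j.
by congr (F _ _ _); lia.
Qed.

Lemma sum_ord_rev m (F : nat -> nat -> V) :
  \sum_(i < m) F i (m - i.+1)%N = \sum_(i < m) F (m - i.+1)%N i.
Proof.
rewrite (reindex_inj rev_ord_inj)/=; apply: eq_bigr => i _.
by congr F; have := ltn_ord i; lia.
Qed.

End IndexSums.

(** * Real-valued sum formulas after cancelling finite terms *)

Section RealIdentities.
Context {R : realType}.
Local Notation z1 i := (mzv R [tuple i%N]).
Local Notation z2 i j := (mzv R [tuple i%N; j%N]).
Local Notation z3 i j k := (mzv R [tuple i%N; j%N; k%N]).

Definition real_cyclic_sum (i j : nat) : R := fine (cyclic_sum i j).

Lemma zeta2_fineK i j : (1 < i)%N -> (0 < j)%N -> zeta2 R i j = (z2 i j)%:E.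
Proof.
case: i => [//|[//|i]] _; case: j => // j _.
by rewrite mzv2E fineK// zeta2_fin.
Qed.

Lemma zeta3_fineK i j k : (1 < i)%N -> (0 < j)%N -> (0 < k)%N ->
  zeta3 R i j k = (z3 i j k)%:E.
Proof.
case: i => [//|[//|i]] _; case: j => // j _; case: k => // k _.
by rewrite mzv3E fineK// zeta3_fin.
Qed.

Lemma cyclic_sum_fineK i j : (0 < i)%N -> (0 < j)%N -> (2 < i + j)%N ->
  cyclic_sum i j = (real_cyclic_sum i j)%:E.
Proof.
case: i => [//|[|i]] _; case: j => [//|[//|j]] _ _.
- by rewrite fineK// cyclic_sum_fin_1.
- by rewrite fineK// cyclic_sum_fin_ge2.
- by rewrite fineK// cyclic_sum_fin_ge2.
Qed.

Lemma depth2_sum m : \sum_(i < m.+1) z2 i.+2 (m - i).+1 = z1 m.+3.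
Proof.
have := @depth2_sum_formula R m.
under eq_bigr do rewrite zeta2_fineK//.
rewrite sumEFin zeta2_fineK// -(fineK (zeta1_fin m.+1)) -mzv1E -!EFinD => -[].
by rewrite addrC => /addrI.
Qed.

Lemma cyclic_relation a k : (0 < k)%N -> (1 < a + k)%N ->
  \sum_(i < a) z3 i.+2 k (a - i) + real_cyclic_sum a.+1 k =
  real_cyclic_sum k a.+1 + z2 k.+1 a.+1.
Proof.
move=> k0 ak; have := @cyclic_sum_formula R a k.
rewrite (eq_bigr (fun i : 'I_a => (z3 i.+2 k (a - i))%:E)); last first.
  by move=> i _; rewrite zeta3_fineK// subn_gt0.
rewrite sumEFin zeta2_fineK// !cyclic_sum_fineK//; [|lia..].
by rewrite -!EFinD => -[].
Qed.

(** Summing [cyclic_relation] over all [a + k = m.+2] with [k > 0], the connecting sums on the two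
    sides agree by reversal, leaving the depth 2 sum of the same weight. *)
Lemma depth3_sum m :
  \sum_(i < m.+1) \sum_(j < (m - i).+1) z3 i.+2 j.+1 ((m - i).+1 - j) = z1 m.+4.
Proof.
rewrite -(sum_triangle_exchange m (fun i j k => z3 i.+2 j.+1 k)) -(depth2_sum m.+1).
apply: (@addIr _ (\sum_(a < m.+2) real_cyclic_sum a.+1 (m.+1 - a).+1)).
rewrite -big_split/=.
under eq_bigr => a _.
  rewrite cyclic_relation//; last by lia.
  over.
rewrite big_split/= addrC; congr (_ + _).
  exact: (sum_ord_rev m.+2 (fun i j => z2 j.+2 i.+1)).
exact: (sum_ord_rev m.+2 (fun i j => real_cyclic_sum j.+1 i.+1)).
Qed.

(** The instance with an empty sum eliminates the connecting sums from the instance [k = 1]. *)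
Lemma cyclic_relation_1 m :
  \sum_(i < m.+1) z3 i.+2 1 (m - i).+1 = z2 m.+3 1 + z2 2 m.+2.
Proof.
have := @cyclic_relation m.+1 1 isT ltac:(lia).
have := @cyclic_relation 0 m.+2 isT isT.
rewrite big_ord0 add0r => ->.
rewrite (eq_bigr (fun i : 'I_m.+1 => z3 i.+2 1 (m - i).+1)); last first.
  by move=> i _; rewrite subSn// -ltnS.
move=> H; apply: (addIr (real_cyclic_sum m.+2 1)); rewrite H; ring.
Qed.

Lemma hoffman_relation_1 m :
  \sum_(i < m.+1) z3 i.+2 (m - i).+1 1 = z2 m.+3 1 + z2 m.+2 2.
Proof.
have := @hoffman_relation R m.
under eq_bigr do rewrite zeta3_fineK//.
rewrite sumEFin !zeta2_fineK// !zeta3_fineK// -!EFinD => -[] H.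
apply: (addIr (z3 m.+2 1 1 + z3 m.+2 1 1)); rewrite H; ring.
Qed.

(** The five families of [stuffle] are summed one by one; reversal identifies the first two. Only
    exponents at least 2 occur in the products, so the boundary terms of the full sum formulas are
    subtracted. *)
Lemma stuffle_sum m :
  (\sum_(i < m) psum3 (fun x y z => recip R x ^+ i.+2 *
      recip R (y + z)%N ^+ (m - i).+1 * recip R z)%R =
  (2 * (z2 m.+3 1 + z2 m.+2 2 - z3 m.+2 1 1) + (z2 m.+3 1 + z2 2 m.+2 - z3 m.+2 1 1)
   + m%:R * z2 m.+3 1 + (z1 m.+4 - z2 m.+2 2 - z2 m.+3 1))%:E)%E.
Proof.
rewrite (eq_bigr (fun i : 'I_m => (z3 i.+2 (m - i).+1 1 + z3 (m - i).+1 i.+2 1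
   + z2 m.+3 1 + z3 (m - i).+1 1 i.+2 + z2 (m - i).+1 i.+3)%:E)); last first.
  move=> i _; have im := ltn_ord i.
  rewrite stuffle !zeta2_fineK ?zeta3_fineK//; [|lia..].
  by rewrite (_ : i.+2 + (m - i).+1 = m.+3)%N//; lia.
rewrite sumEFin; congr (_%:E).
rewrite !big_split/= sumr_const card_ord -mulr_natl.
have H3 := hoffman_relation_1 m; have C3 := cyclic_relation_1 m.
have D2 := depth2_sum m.+1.
rewrite big_ord_recr/= subnn in H3; rewrite big_ord_recr/= subnn in C3.
rewrite !big_ord_recr/= subSnn subnn in D2.
have rev (F : nat -> nat -> R) : \sum_(i < m) F (m - i).+1 i.+2 = \sum_(i < m) F i.+2 (m - i).+1.
  rewrite (reindex_inj rev_ord_inj)/=; apply: eq_bigr => i _.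
  by have im := ltn_ord i; congr F; lia.
rewrite (rev (fun a b => z3 a b 1)) (rev (fun a b => z3 a 1 b)) (rev (fun a b => z2 a b.+1)).
rewrite (eq_bigr (fun i : 'I_m => z2 i.+2 (m - i).+2)) in D2; last first.
  by move=> i _; rewrite subSn// ltnW.
rewrite -H3 -C3 -D2; ring.
Qed.

Definition real_inner_shuffle (i k : nat) : R :=
  \sum_(j < k) z3 i j.+1 (k - j) + z3 i k 1 + z3 i k 1.

Lemma inner_shuffle_fineK i k : (1 < i)%N -> (0 < k)%N ->
  inner_shuffle i k = (real_inner_shuffle i k)%:E.
Proof.
move=> i1 k0; rewrite /inner_shuffle !zeta3_fineK//.
rewrite (eq_bigr (fun j : 'I_k => (z3 i j.+1 (k - j))%:E)); last first.
  by move=> j _; rewrite zeta3_fineK// subn_gt0.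
by rewrite sumEFin.
Qed.

Lemma weighted_sum m :
  \sum_(i < m.+1) 2 ^+ i.+1 * real_inner_shuffle i.+2 (m - i).+1 =
  m.+4%:R * z2 m.+3 1 + 3 * z2 m.+2 2 + z2 2 m.+2 + 2 * z1 m.+4.
Proof.
have := @shuffle_sum R m; rewrite stuffle_sum inner_shuffle_fineK//.
under [X in (_ + X + _ = _)%E]eq_bigr do rewrite inner_shuffle_fineK//.
under [RHS]eq_bigr do rewrite inner_shuffle_fineK// -EFinM.
rewrite !sumEFin -!EFinD => -[] <-.
(* The unweighted inner shuffles contribute one full triple sum and two copies of
   [hoffman_relation_1]. The three copies of z(m+2,1,1) in [real_inner_shuffle m.+2 1] cancel those
   subtracted in [stuffle_sum]. *)
rewrite {1}/real_inner_shuffle !big_split/= depth3_sum hoffman_relation_1.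
rewrite /real_inner_shuffle big_ord1 subn0 -[m.+4]addn4 natrD; ring.
Qed.

End RealIdentities.

(** * Matching the index ranges of the statement with [weighted_sum] *)

Theorem corollary3p3 (R : realType) (n : nat) (hn : (4 <= n)%N) :
  \sum_(2 <= j < n.+1) \sum_(1 <= k < n.+1) \sum_(1 <= l < n.+1 | (j + k + l == n)%N)
     2 ^+ (j - 1) * mzv R [tuple j; k; l]
  + \sum_(2 <= j < n.+1) \sum_(1 <= k < n.+1 | (j + k == n - 1)%N)
     2 ^+ j * mzv R [tuple j; k; 1%N]
  = n%:R * mzv R [tuple (n - 1)%N; 1%N] + 3 * mzv R [tuple (n - 2)%N; 2%N]
    + mzv R [tuple 2%N; (n - 2)%N] + 2 * mzv R [tuple n].
Proof.
have -> : n = (n - 4).+4 by lia.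
move: (n - 4)%N => {hn n} m.
rewrite -[RHS]/(m.+4%:R * mzv R [tuple (m.+4 - 1)%N; 1%N]
  + 3 * mzv R [tuple (m.+4 - 2)%N; 2%N] + mzv R [tuple 2%N; (m.+4 - 2)%N]
  + 2 * mzv R [tuple m.+4]).
rewrite subn1 subn2 /= -weighted_sum.
(* Positivity of the remaining indices forces [j <= m.+2]; larger [j] give empty inner sums. *)
have vanish (F : nat -> R) : \sum_(2 <= j < m.+1.+4 | (j < m.+3)%N) F j =
    \sum_(i < m.+1) F i.+2.
  by rewrite sum_nat_lt; [rewrite !big_add1 big_mkord|lia].
have -> : \sum_(2 <= j < m.+1.+4) \sum_(1 <= k < m.+1.+4)
    \sum_(1 <= l < m.+1.+4 | (j + k + l == m.+4)%N) 2 ^+ (j - 1) * mzv R [tuple j; k; l] =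
    \sum_(i < m.+1) 2 ^+ i.+1 * \sum_(t < (m - i).+1)
      mzv R [tuple i.+2; t.+1; ((m - i).+1 - t)%N].
  transitivity (\sum_(2 <= j < m.+1.+4 | (j < m.+3)%N)
      2 ^+ (j - 1) * \sum_(t < m.+3 - j) mzv R [tuple j; t.+1; (m.+3 - j - t)%N]).
    rewrite [RHS]big_mkcond/=; apply: eq_bigr => j _.
    have inner k : \sum_(1 <= l < m.+1.+4 | (j + k + l == m.+4)%N)
        2 ^+ (j - 1) * mzv R [tuple j; k; l] =
        if (k < m.+4 - j)%N then 2 ^+ (j - 1) * mzv R [tuple j; k; (m.+4 - (j + k))%N] else 0.
      by rewrite (sum_nat_solve _ _ _ (fun l => 2 ^+ (j - 1) * mzv R [tuple j; k; l]))// ltn_subRL.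
    under eq_bigr do rewrite inner.
    rewrite -big_mkcond sum_nat_lt; last by lia.
    rewrite big_add1 big_mkord -mulr_sumr (_ : (m.+4 - j).-1 = m.+3 - j)%N; last by lia.
    case: ltnP => jm.
      congr (_ * _); apply: eq_bigr => t _.
      by rewrite (_ : m.+4 - (j + t.+1) = m.+3 - j - t)%N//; lia.
    by rewrite (_ : m.+3 - j = 0)%N ?big_ord0 ?mulr0//; lia.
  rewrite vanish; apply: eq_bigr => i _; rewrite subn1.
  by rewrite (_ : m.+3 - i.+2 = (m - i).+1)%N//; have := ltn_ord i; lia.
have -> : \sum_(2 <= j < m.+1.+4) \sum_(1 <= k < m.+1.+4 | (j + k == m.+3)%N)
    2 ^+ j * mzv R [tuple j; k; 1%N] =
    \sum_(i < m.+1) 2 ^+ i.+2 * mzv R [tuple i.+2; (m - i).+1; 1%N].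
  transitivity (\sum_(2 <= j < m.+1.+4 | (j < m.+3)%N)
      2 ^+ j * mzv R [tuple j; (m.+3 - j)%N; 1%N]).
    rewrite [RHS]big_mkcond/=; apply: eq_bigr => j _.
    by rewrite (sum_nat_solve _ _ _ (fun k => 2 ^+ j * mzv R [tuple j; k; 1%N])).
  rewrite vanish; apply: eq_bigr => i _.
  by rewrite (_ : m.+3 - i.+2 = (m - i).+1)%N//; have := ltn_ord i; lia.
rewrite -big_split/=; apply: eq_bigr => i _.
(* The weight [2 ^+ i.+2] of the second sum accounts for the two extra copies of z(j,k,1) in
   [real_inner_shuffle], each weighted by [2 ^+ i.+1]. *)
rewrite /real_inner_shuffle [2 ^+ i.+2]exprS; ring.
Qed.
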